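(* For every pair of integers $p,q$ with $\gcd(p,q)=1$ there exists a movable, $(p,q)$-periodic, line-shaped state on $\mathbb{Z}^2$, and it is unique up to translations of $\mathbb{Z}^2$. Furthermore, this state is $(p',q')$-movable, where $p',q'\in\mathbb{Z}$ satisfy $p'q-pq'=1$.
   Context: A state is a function $\phi:\mathbb{Z}^2\to\mathbb{Z}$; $\phi(v)$ is the number of sand grains at $v$. Two points of $\mathbb{Z}^2$ are neighbours if their distance is $1$. Toppling at $v$ is the operation $T_v\phi=\phi+\Delta\delta_v$: $4$ grains are removed from $v$ and each of its four neighbours receives one grain. Here $\Delta\psi(x,y)=-4\psi(x,y)+\psi(x+1,y)+\psi(x-1,y)+\psi(x,y+1)+\psi(x,y-1)$ and $\delta_v$ is the indicator of $v$. A toppling at $v$ is legal if $\phi(v)\ge 4$. A state is stable if $\phi\le 3$ everywhere. A relaxation of $\phi$ is a finite or infinite sequence $\phi_0=\phi,\ \phi_{k+1}=T_{v_k}\phi_k$ with $\phi_k(v_k)\ge 4$. It is locally finite if every vertex topples finitely many times. It is stabilizing if, in addition, the pointwise limit $\phi+\Delta H$ is stable, where $H$ counts the topplings at each vertex. The relaxation of $\phi$ is the result $\phi+\Delta H$ of such a stabilizing locally finite relaxation; it is independent of the choice of relaxation. Sending a wave: let $v\in\mathbb{Z}^2$ be such that $\phi(v)=\phi(w)=3$ for some neighbour $w$ of $v$. Then $W_v\phi$ denotes the state obtained by toppling at $v$ and then relaxing. Let $(p,q)\in\mathbb{Z}^2\setminus\{(0,0)\}$. - A state $\phi$ is $(p,q)$-movable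 if there exists $v$ with $W_v\phi(x,y)=\phi(x+p,y+q)$ for all $(x,y)$. - It is movable if it is $(p',q')$-movable for some $(p',q')\ne(0,0)$. - It is $(p,q)$-periodic if $\phi(x,y)=\phi(x+p,y+q)$ for all $(x,y)$. - It is line-shaped if there are constants $a,b,c_1,c_2$ with $\{\phi\neq 3\}\subset\{(x,y): c_1\le ax+by\le c_2\}$.
   Formalization: Movable is taken to mean that a wave translates the state by a vector that is not a period of it (the wave changes the state), since otherwise the constant state 3 is movable and uniqueness fails; line-shaped requires (a,b) ≠ (0,0). *)

(* Defs.v *)
From HB Require Import structures.
From mathcomp Require Import all_boot all_order all_algebra.
From mathcomp Require Import reals.

Set Implicit Arguments.
Unset Strict Implicit.
Unset Printing Implicit Defensive.

Import Order.TTheory GRing.Theory Num.Theory.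
Local Open Scope ring_scope.

Definition vertex : Type := (int * int)%type.
Definition state : Type := vertex -> int.

(* The squared Euclidean distance is 1. *)
Definition neighbours (v w : vertex) : Prop :=
  (v.1 - w.1) ^+ 2 + (v.2 - w.2) ^+ 2 = 1.

Definition laplacian (psi : state) : state := fun v =>
  - 4 * psi v + psi (v.1 + 1, v.2) + psi (v.1 - 1, v.2)
              + psi (v.1, v.2 + 1) + psi (v.1, v.2 - 1).

Definition delta (v : vertex) : state := fun w => (w == v)%:Z.

Definition topple (v : vertex) (phi : state) : state :=
  fun w => phi w + laplacian (delta v) w.

Definition stable (phi : state) : Prop := forall v, phi v <= 3.

(* A finite or infinite sequence of vertices is a pair of a length
   [N : option nat] ([None] for an infinite sequence) and a function
   [s : nat -> vertex], of which only the values at the indices k with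
   [in_range N k] are meaningful. *)
Definition in_range (N : option nat) (k : nat) : bool :=
  if N is Some n then (k < n)%N else true.

Fixpoint state_after (phi : state) (s : nat -> vertex) (k : nat) : state :=
  if k is k'.+1 then topple (s k') (state_after phi s k') else phi.

Definition relaxation (phi : state) (N : option nat) (s : nat -> vertex)
    : Prop :=
  forall k, in_range N k -> 4 <= state_after phi s k (s k).

Definition topples_at (N : option nat) (s : nat -> vertex) (v : vertex)
    (k : nat) : bool :=
  in_range N k && (s k == v).

Definition locally_finite (N : option nat) (s : nat -> vertex) : Prop :=
  forall v, exists n : nat, forall k, topples_at N s v k -> (k < n)%N.

(* Meaningful for locally finite sequences only: H v is the number of indices
   at which v topples, computed below any bound n on these indices. *)
Definition toppling_count (N : option nat) (s : nat -> vertex)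
    (H : vertex -> nat) : Prop :=
  forall v (n : nat), (forall k, topples_at N s v k -> (k < n)%N) ->
    H v = (\sum_(k < n) topples_at N s v k)%N.

(* [relaxes_to phi psi]: some stabilizing locally finite relaxation of phi has
   result psi.  The result does not depend on the relaxation, so psi is the
   relaxation of phi. *)
Definition relaxes_to (phi psi : state) : Prop :=
  exists (N : option nat) (s : nat -> vertex) (H : vertex -> nat),
    [/\ relaxation phi N s,
        locally_finite N s,
        toppling_count N s H,
        forall v, psi v = phi v + laplacian (fun w => (H w)%:Z) v
      & stable psi].

(* [wave v phi psi]: a wave can be sent from v, and W_v phi is defined and
   equal to psi. *)
Definition wave (v : vertex) (phi psi : state) : Prop :=
  [/\ phi v = 3,
      exists w, neighbours v w /\ phi w = 3
    & relaxes_to (topple v phi) psi].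

Definition translate (p q : int) (phi : state) : state :=
  fun v => phi (v.1 + p, v.2 + q).

Definition periodic (p q : int) (phi : state) : Prop :=
  forall v, phi v = translate p q phi v.

Definition movable_by (p q : int) (phi : state) : Prop :=
  (p, q) <> (0, 0) /\ exists v, wave v phi (translate p q phi).

(* The displacement must not be a period of phi, that is, the wave must change
   phi.  Otherwise the states fixed by a wave would be movable as soon as they
   are periodic: the constant state 3 by any vector, and 3 minus the indicator
   of the multiples of (3,2) by (3,2). *)
Definition movable (phi : state) : Prop :=
  exists p q : int, movable_by p q phi /\ ~ periodic p q phi.

(* For (a, b) = (0, 0) the strip would be empty or the whole plane. *)
Definition line_shaped (R : realType) (phi : state) : Prop :=
  exists a b c1 c2 : R, (a, b) <> (0, 0) /\
    forall x y : int, phi (x, y) <> 3 ->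
      c1 <= a * x%:~R + b * y%:~R <= c2.

Definition equal_up_to_translation (phi psi : state) : Prop :=
  exists s t : int, forall v, psi v = translate s t phi v.

(* Main.v *)
Require Import Defs.
From HB Require Import structures.
From mathcomp Require Import all_boot all_order all_algebra.
From mathcomp Require Import reals.
From mathcomp Require Import boolp zify ring lra.

(* The quotient of Z^2 by (p, q) is Z, via the linear form q x - p y, so a
   periodic state phi <= 3 that is 3 far from a line is 3 + lap F for a
   superharmonic F : Z -> Z, and a wave adds to F the least h in {0,1} that is
   1 at its source and keeps F superharmonic.

   Call F a profile if its slope is in {0,1}, it is n far left and 0 far right.
   Where F is harmonic on a long interval its slope is constant, being harmonic
   with two values; since the total mass of lap F is p^2 + q^2, all profiles
   have their mass in a common window, so there is a least profile.  A wave from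
   far left adds to it a function h such that F + h is a translated profile
   lying below F(. + 1); by minimality F + h = F(. + 1).

   Conversely, integrating the wave of a movable state along its displacement
   gives a potential F, whose harmonic left end has an integral slope; this
   forces the displacement to be one step, and F is a profile up to translation.
   The least action principle for iterated waves shows that F is below any other
   profile, hence is the least one. *)

Set Implicit Arguments.
Unset Strict Implicit.
Unset Printing Implicit Defensive.

Import Order.TTheory GRing.Theory Num.Theory.
Local Open Scope ring_scope.

(** * Relaxations and waves *)

Lemma laplacianD (f g : state) v :
  laplacian (fun w => f w + g w) v = laplacian f v + laplacian g v.
Proof. by rewrite /laplacian; ring. Qed.

Lemma laplacianB (f g : state) v :
  laplacian (fun w => f w - g w) v = laplacian f v - laplacian g v.
Proof. by rewrite /laplacian; ring. Qed.

Lemma eq_laplacian (f g : state) : f =1 g -> laplacian f =1 laplacian g.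
Proof. by move=> e v; rewrite /laplacian !e. Qed.

Lemma laplacian_translate s t (f : state) v :
  laplacian (translate s t f) v = laplacian f (v.1 + s, v.2 + t).
Proof.
rewrite /laplacian /translate /=; case: v => x y /=.
by rewrite !(addrAC _ s) !(addrAC _ t).
Qed.

Lemma state_afterE (s : nat -> vertex) phi N k :
  (forall i, (i < k)%N -> in_range N i) ->
  state_after phi s k =1
    (fun v => phi v + laplacian (fun w => (\sum_(i < k) topples_at N s w i)%N%:Z) v).
Proof.
elim: k => [|k IH] hk v /=.
  by rewrite /laplacian !big_ord0; ring.
rewrite /topple IH; last by move=> i ik; apply: hk; apply: ltnW.
rewrite -addrA -laplacianD; congr (_ + _); apply: eq_laplacian => w.
by rewrite big_ord_recr /= /topples_at hk // PoszD eq_sym.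
Qed.

(** A toppling that first pushed the count at [v] above [X v] would start from equality at [v] and
    counts at most [X] at the neighbours; then [v] would hold at most [phi v + laplacian X v <= 3]
    grains and could not topple. *)
Lemma least_action N s (phi X : state) :
  relaxation phi N s -> (forall v, 0 <= X v) ->
  (forall v, phi v + laplacian X v <= 3) ->
  forall k v, (\sum_(i < k) topples_at N s v i)%N%:Z <= X v.
Proof.
move=> hr X0 hX; elim=> [|k IH] v; first by rewrite big_ord0.
rewrite big_ord_recr /=.
case: (boolP (topples_at N s v k)) => [/andP[hk /eqP sk]|_]; last by rewrite addn0.
have hin i : (i < k)%N -> in_range N i.
  by case: (N) hk => //= n kn ik; exact: ltn_trans ik kn.
have := hr k hk; rewrite sk (@state_afterE s phi N) // => h4.
move: (hX v) h4; rewrite /laplacian.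
have := IH v; have := IH (v.1 + 1, v.2); have := IH (v.1 - 1, v.2).
have := IH (v.1, v.2 + 1); have := IH (v.1, v.2 - 1).
rewrite addn1; move: (\sum_(_ < k) _)%N (\sum_(_ < k) _)%N (\sum_(_ < k) _)%N.
move: (X v) (phi v) (X _) (X _) (X _) (X _) (\sum_(_ < k) _)%N (\sum_(_ < k) _)%N.
lia.
Qed.

Lemma eq_sum_bound (P : nat -> bool) m n :
  (forall k, P k -> (k < m)%N) -> (m <= n)%N ->
  (\sum_(k < n) P k = \sum_(k < m) P k)%N.
Proof.
move=> hP mn; rewrite -(subnKC mn) big_split_ord /= [X in (_ + X)%N]big1 ?addn0 //.
move=> i _; case: (boolP (P _)) => // /hP; lia.
Qed.

Lemma bounded_sum_support (P : nat -> bool) B :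
  (forall n, (\sum_(k < n) P k <= B)%N) ->
  exists n, forall k, P k -> (k < n)%N.
Proof.
move=> hB.
pose Q b := `[< exists n, \sum_(k < n) P k = b >]%N.
have exQ : exists b, Q b by exists 0%N; apply/asboolP; exists 0%N; rewrite big_ord0.
have ubQ b : Q b -> (b <= B)%N by move=> /asboolP[n <-].
case: (ex_maxnP exQ ubQ) => b /asboolP[n nb] hmax.
exists n => k Pk; rewrite ltnNge; apply/negP => nk.
have := hmax (\sum_(i < k.+1) P i)%N; rewrite -nb.
have -> : Q (\sum_(i < k.+1) P i)%N by apply/asboolP; exists k.+1.
rewrite big_ord_recr /= Pk -(subnKC nk) big_split_ord /= => /(_ isT); lia.
Qed.

(* Toppling always the unstable vertex of least code is a fair strategy: a
   vertex that stays unstable forces topplings of smaller codes forever. *)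
Lemma relaxes_to_exists (phi X : state) :
  (forall v, 0 <= X v) -> (forall v, phi v + laplacian X v <= 3) ->
  exists psi, relaxes_to phi psi.
Proof.
move=> X0 hX.
have /choice[u hu] : forall chi : state, exists x : vertex, ~ stable chi ->
    4 <= chi x /\ forall w, 4 <= chi w -> (pickle x <= pickle w)%N.
  move=> chi.
  have [sc|/existsNP[v /negP]] := pselect (stable chi); first by exists (0, 0).
  rewrite -ltNge => hv.
  pose Q b := `[< exists2 x : vertex, pickle x = b & 4 <= chi x >].
  have exQ : exists b, Q b by exists (pickle v); apply/asboolP; exists v => //; lia.
  case: (ex_minnP exQ) => b /asboolP[x xb hx] hmin.
  exists x => _; split=> // w hw; rewrite xb; apply: hmin.
  by apply/asboolP; exists w.
pose st := fix st k := if k is k'.+1 then topple (u (st k')) (st k') else phi.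
pose s k := u (st k).
have stE k : state_after phi s k = st k by elim: k => //= k ->.
have [N [hNr hN]] : exists N, (forall k, in_range N k -> ~ stable (st k)) /\
    (if N is Some n then stable (st n) else True).
  have [[n hn]|hn] := pselect (exists n, stable (st n)); last first.
    by exists None; split=> // k _ hk; apply: hn; exists k.
  have exQ : exists n, `[< stable (st n) >] by exists n; apply/asboolP.
  case: (ex_minnP exQ) => b /asboolP hb hmin.
  exists (Some b); split=> //= k kb hk.
  by have := hmin k; rewrite leqNgt kb => /(_ (introT (asboolP _) hk)).
have hrel : relaxation phi N s.
  by move=> k /hNr hk; rewrite stE; case: (hu _ hk).
pose T v k := topples_at N s v k.
have cntX k v : (\sum_(i < k) T v i)%N%:Z <= X v by apply: least_action hrel X0 hX k v.
have /choice[b hb] : forall v, exists n, forall k, T v k -> (k < n)%N.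
  move=> v; apply: (@bounded_sum_support _ `|X v|%N) => n.
  by have := cntX n v; have := X0 v; lia.
pose H v := (\sum_(k < b v) T v k)%N.
have HE v n : (forall k, T v k -> (k < n)%N) -> H v = (\sum_(k < n) T v k)%N.
  move=> hn; have [le|le] := leqP (b v) n.
    by rewrite (eq_sum_bound (hb v) le).
  by rewrite /H (eq_sum_bound hn (ltnW le)).
exists (fun v => phi v + laplacian (fun w => (H w)%:Z) v).
exists N, s, H; split=> // [v|v].
  by exists (b v); apply: hb.
(* Once [w] and its neighbours have made their last topplings, the state at [w] has its limit
   value. *)
have stcnt k w : (forall i, (i < k)%N -> in_range N i) ->
    (forall i, T w i -> (i < k)%N) ->
    (forall x, neighbours w x -> forall i, T x i -> (i < k)%N) ->
    st k w = phi w + laplacian (fun w => (H w)%:Z) w.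
  move=> hk bw bx; rewrite -stE (@state_afterE s phi N) //.
  have nE x : neighbours w x -> H x = (\sum_(i < k) T x i)%N.
    by move=> wx; apply: HE; apply: bx.
  rewrite /laplacian -(HE w) // -(nE (w.1 + 1, w.2)) -?(nE (w.1 - 1, w.2))
    -?(nE (w.1, w.2 + 1)) -?(nE (w.1, w.2 - 1)) // /neighbours /=; ring.
case: N hNr hN hrel @T cntX hb @H HE stcnt => [n|] hNr hN hrel T cntX hb H HE stcnt.
  rewrite -(stcnt n) // => [i /andP[] //|x _ i /andP[] //].
rewrite leNgt; apply/negP => hv.
(* [K] bounds the last topplings of all vertices of code at most that of [v]. At time [K'] the
   neighbours of [v] are finished too, so [v] is still unstable, and the next toppling would be at
   such a vertex. *)
have [K hK] : exists K, forall x : vertex, (pickle x <= (pickle v).+1)%N -> (b x <= K)%N.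
  elim: (pickle v).+1 => [|M [K hK]].
    pose x0 := odflt v (unpickle 0); exists (b x0) => x; rewrite leqn0 => /eqP e.
    by rewrite /x0 -e pickleK.
  exists (maxn K (b (odflt v (unpickle M.+1)))) => x; rewrite leq_eqVlt => /orP[/eqP e|xM].
    by rewrite -e pickleK leq_maxr.
  by rewrite leq_max hK.
pose K' := addn (K + b v) (b (v.1 + 1, v.2)%R + b (v.1 - 1, v.2)%R
  + (b (v.1, v.2 + 1)%R + b (v.1, v.2 - 1)%R)).
have hK' : st K' v = phi v + laplacian (fun w => (H w)%:Z) v.
  apply: stcnt => // [i /hb|x]; first by rewrite /K'; lia.
  rewrite /neighbours => vx i /hb.
  have : [|| x == (v.1 + 1, v.2), x == (v.1 - 1, v.2), x == (v.1, v.2 + 1)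
           | x == (v.1, v.2 - 1)].
    case: x vx {i} => x y /=; rewrite !xpair_eqE; nia.
  by case/or4P => /eqP->; rewrite /K'; lia.
have [h4 hmin] := hu _ (hNr K' isT).
have hu4 : (pickle (s K') <= pickle v)%N by apply: hmin; rewrite hK'; lia.
have := hb (s K') K'; rewrite /T /topples_at /= eqxx => /(_ isT).
by have := hK (s K') (leqW hu4); rewrite /K'; lia.
Qed.

(** [h] counts all topplings of the wave, the first one at [v] included. Taking this one away turns
    [X] into a competitor for [topple v phi], where [least_action] applies; the constant 1 gives
    [h <= 1]. *)
Lemma wave_minimal phi psi v : stable phi -> wave v phi psi ->
  exists h : state,
  [/\ forall w, 0 <= h w <= 1, h v = 1,
      forall w, psi w = phi w + laplacian h w,
      stable psi
    & forall X : state, (forall w, 0 <= X w) -> 1 <= X v ->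
        (forall w, phi w + laplacian X w <= 3) -> forall w, h w <= X w].
Proof.
move=> sphi [v3 _ [N [s [H [hr lf tc hpsi spsi]]]]].
pose h : state := fun w => (H w)%:Z + delta v w.
have hmin (X : state) : (forall w, 0 <= X w) -> 1 <= X v ->
    (forall w, phi w + laplacian X w <= 3) -> forall w, h w <= X w.
  move=> X0 Xv hX w.
  have [n hn] := lf w; rewrite /h (tc w n hn) -lerBrDr.
  apply: (@least_action N s (topple v phi) (fun x => X x - delta v x)) => // x.
    by rewrite /delta; have := X0 x; case: eqP => [->|_]; lia.
  by rewrite /topple laplacianB; have := hX x; lia.
have hv : 1 <= h v by rewrite /h /delta eqxx; lia.
have h1 w : h w <= 1.
  apply: (hmin (fun=> 1)) => // x; have := sphi x; rewrite /laplacian; lia.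
exists h; split=> //.
- by apply/eqP; rewrite eq_le h1 hv.
- by move=> w; rewrite hpsi /topple laplacianD; ring.
Qed.

(** After the toppling at [v], toppling every other vertex once restores the stable state [phi];
    this bounds the relaxation. *)
Lemma wave_exists phi v w : stable phi -> phi v = 3 -> phi w = 3 -> neighbours v w ->
  exists psi, wave v phi psi.
Proof.
move=> sphi v3 w3 vw.
have [x|x|psi hpsi] := @relaxes_to_exists (topple v phi) (fun x => 1 - delta v x).
- by rewrite /delta; case: eqP => _; lia.
- rewrite /topple laplacianB; have := sphi x; rewrite {2}/laplacian; lia.
by exists psi; split=> //; exists w.
Qed.

Lemma eq_wave phi psi psi' v : psi =1 psi' -> wave v phi psi -> wave v phi psi'.
Proof.
move=> e [v3 hw [N [s [H [hr lf tc hpsi spsi]]]]].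
split=> //; exists N, s, H; split=> // x; rewrite -e; [exact: hpsi|exact: spsi].
Qed.

(** * Reduction to one dimension *)

Lemma bounded_below_attains (T : Type) (f : T -> int) (B : int) (x0 : T) :
  (forall x, B <= f x) -> exists x, forall y, f x <= f y.
Proof.
move=> hB.
have exQ : exists n : nat, `[< exists x, f x = B + n%:Z >].
  by exists `|f x0 - B|%N; apply/asboolP; exists x0; have := hB x0; lia.
case: (ex_minnP exQ) => n /asboolP[x xn] hmin.
exists x => y; rewrite xn.
have : (n <= `|f y - B|)%N.
  by apply: hmin; apply/asboolP; exists y; have := hB y; lia.
have := hB y; lia.
Qed.

Lemma vertex_connected (P : vertex -> Prop) v0 :
  (forall v, P v -> [/\ P (v.1 + 1, v.2), P (v.1 - 1, v.2),
                        P (v.1, v.2 + 1) & P (v.1, v.2 - 1)]) ->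
  P v0 -> forall v, P v.
Proof.
move=> hP P0 [x y].
have P1 : P (x, v0.2).
  rewrite -(subrK v0.1 x); case: (x - v0.1) => n.
    elim: n => [|n IH]; first by rewrite add0r; case: v0 P0.
    by have [+ _ _ _] := hP _ IH; congr P; congr pair; rewrite /=; lia.
  elim: n => [|n IH].
    by have [_ + _ _] := hP _ P0; congr P; congr pair; rewrite /=; lia.
  by have [_ + _ _] := hP _ IH; congr P; congr pair; rewrite /=; lia.
rewrite -(subrK v0.2 y); case: (y - v0.2) => n.
  elim: n => [|n IH]; first by rewrite add0r.
  by have [_ _ + _] := hP _ IH; congr P; congr pair; rewrite /=; lia.
elim: n => [|n IH].
  by have [_ _ _ +] := hP _ P1; congr P; congr pair; rewrite /=; lia.
by have [_ _ _ +] := hP _ IH; congr P; congr pair; rewrite /=; lia.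
Qed.

(** An integer-valued function bounded below attains its minimum, and superharmonicity spreads the
    minimum to all neighbours. *)
Lemma superharmonic_constant (F : state) (B : int) :
  (forall v, laplacian F v <= 0) -> (forall v, B <= F v) ->
  forall v w, F v = F w.
Proof.
move=> sF hB.
have [v0 hv0] := bounded_below_attains ((0, 0) : vertex) hB.
suff h v : F v = F v0 by move=> v w; rewrite !h.
apply: (vertex_connected (P := fun v => F v = F v0) (v0 := v0)) => // {}v e.
have := sF v; rewrite /laplacian e.
have := hv0 (v.1 + 1, v.2); have := hv0 (v.1 - 1, v.2).
have := hv0 (v.1, v.2 + 1); have := hv0 (v.1, v.2 - 1).
by move: (F _) (F _) (F _) (F _) (F _) => *; split; lia.
Qed.

(* The quotient of Z^2 by (p, q) is Z via [height], and the Laplacian descends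
   to [lap]. *)
Definition height (p q : int) (v : vertex) : int := q * v.1 - p * v.2.

Definition lap (p q : int) (f : int -> int) (n : int) : int :=
  f (n + q) + f (n - q) + f (n + p) + f (n - p) - 4 * f n.

Lemma laplacian_height (p q : int) (f : int -> int) v :
  laplacian (fun w => f (height p q w)) v = lap p q f (height p q v).
Proof.
rewrite /laplacian /lap /height /=.
have -> : q * (v.1 + 1) - p * v.2 = q * v.1 - p * v.2 + q by ring.
have -> : q * (v.1 - 1) - p * v.2 = q * v.1 - p * v.2 - q by ring.
have -> : q * v.1 - p * (v.2 + 1) = q * v.1 - p * v.2 - p by ring.
have -> : q * v.1 - p * (v.2 - 1) = q * v.1 - p * v.2 + p by ring.
ring.
Qed.

Lemma height_mul (p q p' q' : int) n : p' * q - p * q' = 1 ->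
  height p q (n * p', n * q') = n.
Proof. by move=> e; rewrite /height /= -[RHS]mulr1 -e; ring. Qed.

Lemma periodic_mul (p q : int) phi (k : int) v : periodic p q phi ->
  phi v = phi (v.1 + k * p, v.2 + k * q).
Proof.
move=> hp.
have hn (n : nat) (w : vertex) : phi w = phi (w.1 + n%:Z * p, w.2 + n%:Z * q).
  elim: n => [|n ->]; first by rewrite !mul0r !addr0; case: w.
  by rewrite hp /translate /=; congr phi; congr pair; lia.
case: k => n; first exact: hn.
rewrite [RHS](hn n.+1) /=; case: v => x y /=; congr phi; congr pair; rewrite NegzE; lia.
Qed.

Lemma periodic_height (p q p' q' : int) phi v : p' * q - p * q' = 1 -> periodic p q phi ->
  phi v = phi (height p q v * p', height p q v * q').
Proof.
move=> e hp; rewrite (periodic_mul (q' * v.1 - p' * v.2) v hp).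
congr phi; congr pair; rewrite /height.
  by rewrite -{1}[v.1]mulr1 -e; ring.
by rewrite -{1}[v.2]mulr1 -e; ring.
Qed.

Lemma lap_constant (p q p' q' : int) (f : int -> int) (B : int) : p' * q - p * q' = 1 ->
  (forall n, lap p q f n <= 0) -> (forall n, B <= f n) -> forall m n, f m = f n.
Proof.
move=> e hf hB m n.
rewrite -(height_mul m e) -(height_mul n e).
apply: (@superharmonic_constant (fun v => f (height p q v)) B) => // v.
by rewrite laplacian_height.
Qed.

Lemma walk (D P : int -> Prop) (s : int) :
  (forall i, D i -> P i -> P (i + s) /\ P (i - s)) ->
  forall k j, (forall i, `|i - j| <= `|k * s| -> D i) -> P j -> P (j + k * s).
Proof.
move=> hP k j hD Pj.
have hn (n : nat) : (n <= `|k|)%N -> P (j + n%:Z * s) /\ P (j - n%:Z * s).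
  elim: n => [|n IH] hnk; first by rewrite mul0r ?subr0 ?addr0.
  have [h1 h2] := IH (ltnW hnk).
  have hle : `|n%:Z * s| <= `|k * s| by rewrite !normrM ler_wpM2r //; lia.
  have [h3 _] := hP _ (hD (j + n%:Z * s) ltac:(lia)) h1.
  have [_ h4] := hP _ (hD (j - n%:Z * s) ltac:(lia)) h2.
  by split; [move: h3|move: h4]; congr P; lia.
have [h1 h2] := hn _ (leqnn _).
have [k0|k0] := leP 0 k; first by rewrite -[k]gez0_abs.
by rewrite -[k]opprK -(ltz0_abs k0) mulNr.
Qed.

(** Since [1 = p' * q - q' * p], a unit step is a walk by steps of length [q] and then [p], which
    stays within |p' q| + |q' p| of its start. *)
Lemma walk_unit (p q p' q' : int) (D P : int -> Prop) : p' * q - p * q' = 1 ->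
  (forall i, D i -> P i -> [/\ P (i + q), P (i - q), P (i + p) & P (i - p)]) ->
  forall j, (forall i, `|i - j| <= `|p' * q| + `|q' * p| -> D i) -> P j ->
  P (j + 1) /\ P (j - 1).
Proof.
move=> e hP j hD Pj.
have hq i : D i -> P i -> P (i + q) /\ P (i - q) by move=> Di /(hP _ Di)[].
have hp i : D i -> P i -> P (i + p) /\ P (i - p) by move=> Di /(hP _ Di)[].
split.
  have h1 : P (j + p' * q) by apply: (walk hq) => // i hi; apply: hD; lia.
  have -> : j + 1 = j + p' * q + (- q') * p by rewrite -e; ring.
  by apply: (walk hp) => // i; rewrite mulNr normrN => hi; apply: hD; lia.
have h1 : P (j + (- p') * q).
  by apply: (walk hq) => // i; rewrite mulNr normrN => hi; apply: hD; lia.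
have -> : j - 1 = j + (- p') * q + q' * p by rewrite -e; ring.
by apply: (walk hp) => // i hi; apply: hD; move: hi; rewrite mulNr; lia.
Qed.

(** * Profiles *)

Lemma int_up_ind (m : int) (P : int -> Prop) :
  P m -> (forall n, m <= n -> P n -> P (n + 1)) -> forall n, m <= n -> P n.
Proof.
move=> Pm hP n mn; have -> : n = m + `|n - m|%N%:Z by lia.
elim: `|n - m|%N => [|k IH]; first by rewrite addr0.
have -> : m + k.+1%:Z = m + k%:Z + 1 by lia.
by apply: hP => //; lia.
Qed.

Definition slow (F : int -> int) : Prop := forall n, F n <= F (n + 1) <= F n + 1.

Lemma slow_between (F : int -> int) (m n : int) : slow F -> m <= n ->
  F m <= F n <= F m + (n - m).
Proof.
move=> sF; move: n.
apply: (@int_up_ind m (fun n => F m <= F n <= F m + (n - m))) => [|n mn IH].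
  by rewrite subrr addr0 lexx.
by have := sF n; lia.
Qed.

Lemma linear_on (F : int -> int) (c a b : int) :
  (forall i, a <= i < b -> F (i + 1) = F i + c) ->
  forall m, a <= m <= b -> F m = F a + c * (m - a).
Proof.
move=> hF m /andP[am mb]; move: m am mb.
apply: (@int_up_ind a (fun m => m <= b -> F m = F a + c * (m - a))) => [_|m am IH mb].
  by rewrite subrr mulr0 addr0.
by rewrite hF ?IH; [ring|lia|lia].
Qed.

Lemma lap_norm (p q : int) f (n : int) : lap p q f n = lap `|p| `|q| f n.
Proof.
by rewrite /lap; case: (ger0P p) => _; case: (ger0P q) => _; rewrite ?opprK; ring.
Qed.

(** A window sum whose increment in [n] is the second difference of [F] with step [P]
    ([flux1_step]), that is, one of the two directions of [lap]. *)
Definition flux1 (P : nat) (F : int -> int) (n : int) : int :=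
  \sum_(i < P) (F (n - i%:Z + P%:Z) - F (n - i%:Z)).

Lemma flux1_step P (F : int -> int) (n : int) :
  flux1 P F n - flux1 P F (n - 1) = F (n + P%:Z) + F (n - P%:Z) - 2 * F n.
Proof.
pose A j := F (j + P%:Z) - F j.
have tel k : \sum_(i < k) (A (n - i%:Z) - A (n - 1 - i%:Z)) = A n - A (n - k%:Z).
  elim: k => [|k IH]; first by rewrite big_ord0 subr0 subrr.
  rewrite big_ord_recr /= IH; have -> : n - 1 - k%:Z = n - k.+1%:Z by lia.
  by ring.
by rewrite /flux1 -sumrB tel /A subrK; ring.
Qed.

Lemma flux1_bounds P (F : int -> int) (n : int) : slow F ->
  0 <= flux1 P F n <= (P * P)%N%:Z.
Proof.
move=> sF; have ht (i : int) : 0 <= F (i + P%:Z) - F i <= P%:Z.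
  by have := @slow_between F i (i + P%:Z) sF; lia.
apply/andP; split; first by apply: sumr_ge0 => i _; case/andP: (ht (n - i%:Z)).
have -> : (P * P)%N%:Z = \sum_(i < P) P%:Z.
  by rewrite sumr_const card_ord PoszM -mulr_natr natz.
by apply: ler_sum => i _; case/andP: (ht (n - i%:Z)).
Qed.

(** The term [i = 0] spans the step from [n] to [n + 1]: slope 1 there makes it at least 1, slope 0
    keeps it at most [P - 1]. *)
Lemma flux1_slope P (F : int -> int) (n : int) : slow F -> (0 < P)%N ->
  F (n + 1) - F n <= flux1 P F n <= (P * P)%N%:Z - 1 + (F (n + 1) - F n).
Proof.
case: P => // P sF _; have ht (i : int) : 0 <= F (i + P.+1%:Z) - F i <= P.+1%:Z.
  by have := @slow_between F i (i + P.+1%:Z) sF; lia.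
rewrite /flux1 big_ord_recl /= subr0.
have h1 : 0 <= \sum_(i < P) (F (n - (bump 0 i)%:Z + P.+1%:Z) - F (n - (bump 0 i)%:Z)).
  by apply: sumr_ge0 => i _; case/andP: (ht (n - (bump 0 i)%:Z)).
have h2 : \sum_(i < P) (F (n - (bump 0 i)%:Z + P.+1%:Z) - F (n - (bump 0 i)%:Z))
    <= (P * P.+1)%N%:Z.
  have -> : (P * P.+1)%N%:Z = \sum_(i < P) P.+1%:Z.
    by rewrite sumr_const card_ord PoszM mulrC -mulr_natr natz.
  by apply: ler_sum => i _; case/andP: (ht (n - (bump 0 i)%:Z)).
have := @slow_between F (n + 1) (n + P.+1%:Z) sF.
move: h1 h2; move: (\sum_(i < P) _ : int) => S; have := sF n; lia.
Qed.

Lemma flux1_linear P (F : int -> int) (c a b n : int) :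
  (forall i, a <= i < b -> F (i + 1) = F i + c) ->
  a <= n - P%:Z -> n + P%:Z <= b -> flux1 P F n = c * (P * P)%N%:Z.
Proof.
move=> hF an nb; rewrite /flux1 (eq_bigr (fun=> c * P%:Z)) => [|i _].
  by rewrite sumr_const card_ord PoszM mulrA -mulr_natr natz.
have := ltn_ord i => iP.
rewrite (linear_on hF (m := n - i%:Z + P%:Z)); last by lia.
by rewrite (linear_on hF (m := n - i%:Z)); [ring|lia].
Qed.

(* By [flux_step], the flux decreases by the mass [- lap F n] at [n]; it is
   [p^2 + q^2] where the slope of [F] is [1], and [0] where it is [0]. *)
Definition flux (p q : int) (F : int -> int) (n : int) : int :=
  flux1 `|p| F n + flux1 `|q| F n.

Lemma flux_step (p q : int) (F : int -> int) (n : int) :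
  flux p q F n - flux p q F (n - 1) = lap p q F n.
Proof.
rewrite lap_norm /lap /flux -!abszE.
by have := flux1_step `|p| F n; have := flux1_step `|q| F n; lia.
Qed.

Lemma flux_anti (p q : int) (F : int -> int) : (forall n, lap p q F n <= 0) ->
  forall m n, m <= n -> flux p q F n <= flux p q F m.
Proof.
move=> hF m; apply: (@int_up_ind m (fun n => flux p q F n <= flux p q F m)) => // n mn IH.
by have := flux_step p q F (n + 1); have := hF (n + 1); rewrite addrK; lia.
Qed.

Definition total (p q : int) : nat := (`|p| * `|p| + `|q| * `|q|)%N.

Lemma flux_bounds (p q : int) (F : int -> int) (n : int) : slow F ->
  0 <= flux p q F n <= (total p q)%:Z.
Proof.
move=> sF; have := flux1_bounds `|p| n sF; have := flux1_bounds `|q| n sF.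
by rewrite /flux /total PoszD; lia.
Qed.

(** Flux [total p q] thus forces slope 1, and flux 0 forces slope 0. The Bezout relation makes [p]
    or [q] nonzero, and [flux1_slope] applies to it. *)
Lemma flux_slope (p q p' q' : int) (F : int -> int) (n : int) :
  p' * q - p * q' = 1 -> slow F ->
  F (n + 1) - F n <= flux p q F n <= (total p q)%:Z - 1 + (F (n + 1) - F n).
Proof.
move=> e sF; have := flux1_bounds `|p| n sF; have := flux1_bounds `|q| n sF.
have := sF n; rewrite /flux /total PoszD.
have [p0|p0] := posnP `|p|%N; last by have := flux1_slope n sF p0; lia.
have q0 : (0 < `|q|)%N by rewrite lt0n; apply/eqP => q0; move: e; nia.
by have := flux1_slope n sF q0; lia.
Qed.

(* On a long interval where [F] is harmonic, its slope is harmonic with values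
   in {0,1}; an extreme value spreads to all neighbours, so the slope is
   constant. *)
Lemma flux_constant (p q p' q' : int) (F : int -> int) (n K : int) :
  p' * q - p * q' = 1 -> slow F ->
  (forall n, lap p q F n <= 0) ->
  `|p' * q| + `|q' * p| + `|p| + `|q| + 2 <= K ->
  flux p q F (n + K + K) = flux p q F n ->
  flux p q F n = 0 \/ flux p q F n = (total p q)%:Z.
Proof.
move=> e sF hF hK fK.
have fE (i : int) : n <= i <= n + K + K -> flux p q F i = flux p q F n.
  move=> /andP[ni iK]; apply/eqP; rewrite eq_le (flux_anti hF ni) -fK.
  by rewrite flux_anti.
have l0 (i : int) : n < i <= n + K + K -> lap p q F i = 0.
  by move=> hi; rewrite -flux_step (fE i) ?(fE (i - 1)) ?subrr //; lia.
(* From the midpoint [a], [K] leaves room for the walks of [walk_unit] started anywhere in the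
   window seen by the flux at [a]. *)
set a := n + K.
have [c [c01 cE]] : exists c : int, 0 <= c <= 1 /\ F (a + 1) = F a + c.
  by exists (F (a + 1) - F a); have := sF a; lia.
pose P (i : int) := F (i + 1) = F i + c.
have spread (i : int) : n < i < n + K + K -> P i ->
    [/\ P (i + q), P (i - q), P (i + p) & P (i - p)].
  move=> hi; rewrite /P => Pi.
  have := l0 i ltac:(lia); have := l0 (i + 1) ltac:(lia); rewrite /lap Pi.
  rewrite !(addrAC i 1); have := sF (i + q); have := sF (i - q).
  have := sF (i + p); have := sF (i - p).
  move: (F (i + q)) (F (i - q)) (F (i + p)) (F (i - p)) (F i) => A1 A2 A3 A4 A0.
  move: (F (i + q + 1)) (F (i - q + 1)) (F (i + p + 1)) (F (i - p + 1)).
  by clear -c01; have [->|->] : c = 0 \/ c = 1; [lia|..]; move=> *; split; lia.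
have wk (j : int) : `|j - a| <= `|p| + `|q| -> P j -> P (j + 1) /\ P (j - 1).
  move=> hj; apply: (walk_unit e spread) => i hi.
  move: hi hj hK; rewrite /a; move: `|p' * q| `|q' * p| `|p| `|q| => *; lia.
have hP (k : nat) : k%:Z <= `|p| + `|q| -> P (a + k%:Z) /\ P (a - k%:Z).
  elim: k => [|k IH] hk; first by rewrite ?subr0 ?addr0.
  have [h1 h2] := IH ltac:(lia).
  have [h3 _] := wk (a + k%:Z) ltac:(lia) h1.
  have [_ h4] := wk (a - k%:Z) ltac:(lia) h2.
  by split; [move: h3|move: h4]; congr P; lia.
have hlin (i : int) : a - (`|p| + `|q|) <= i < a + (`|p| + `|q|) -> F (i + 1) = F i + c.
  move=> hi; have [ai|ai] := leP a i.
    have [+ _] := hP `|i - a|%N ltac:(lia).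
    by rewrite /P; have -> : a + `|i - a|%N%:Z = i by lia.
  have [_ +] := hP `|i - a|%N ltac:(lia).
  by rewrite /P; have -> : a - `|i - a|%N%:Z = i by lia.
have : flux p q F a = c * (total p q)%:Z.
  rewrite /flux /total PoszD mulrDr.
  by rewrite !(flux1_linear hlin) // ?abszE; lia.
rewrite fE ?/a; last by lia.
have [->|->] : c = 0 \/ c = 1 by lia.
  by rewrite mul0r; left.
by rewrite mul1r; right.
Qed.

Definition profile (p q : int) (F : int -> int) : Prop :=
  [/\ slow F, forall n, lap p q F n <= 0
    & exists R : int, forall n : int, (n <= - R -> F n = n) /\ (R <= n -> F n = 0)].

Lemma profile_le (p q : int) (F : int -> int) (n : int) :
  profile p q F -> F n <= n /\ F n <= 0.
Proof.
move=> [sF _ [R hR]].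
have [mi ma] : Order.min n (- R) <= n /\ n <= Order.max n R by lia.
have := slow_between sF mi; have := slow_between sF ma.
have [h1 _] := hR (Order.min n (- R)); have [_ h2] := hR (Order.max n R).
by rewrite h1 ?h2; lia.
Qed.

(** The flux falls from [D] to 0, and by [flux_constant] it cannot keep an intermediate value over a
    block of length [K + K]. So the descent fits in [D] blocks, whatever the profile, and
    [profile_le] locates it near 0. *)
Lemma profile_support (p q p' q' : int) : p' * q - p * q' = 1 ->
  exists2 R : int, 0 <= R & forall F, profile p q F ->
    forall n : int, (n <= - R -> F n = n) /\ (R <= n -> F n = 0).
Proof.
move=> e; pose K : int := `|p' * q| + `|q' * p| + `|p| + `|q| + 2.
have K0 : 0 <= K by rewrite /K; lia.
pose D := total p q; pose R := (K + K) * D%:Z + 1.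
have R0 : 0 <= R by rewrite /R; nia.
exists R => // F pF; have [sF hF [R1 hR1]] := pF.
have drop (n : int) : flux p q F n < D%:Z -> flux p q F (n + (K + K) * D%:Z) = 0.
  move=> fD.
  have hk (k : nat) : flux p q F (n + (K + K) * k%:Z) <= Order.max 0 (D%:Z - 1 - k%:Z).
    elim: k => [|k IH]; first by rewrite mulr0 addr0; lia.
    have E : n + (K + K) * k.+1%:Z = n + (K + K) * k%:Z + K + K by lia.
    have := @flux_anti p q F hF (n + (K + K) * k%:Z) (n + (K + K) * k.+1%:Z).
    have := @flux_anti p q F hF n (n + (K + K) * k%:Z).
    have := @flux_constant p q p' q' F (n + (K + K) * k%:Z) K e sF hF (lexx _).
    rewrite -E -/D; have [eq|neq] := eqVneq (flux p q F (n + (K + K) * k.+1%:Z))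
      (flux p q F (n + (K + K) * k%:Z)).
      move=> /(_ eq); rewrite eq; have : 0 <= (K + K) * k%:Z by rewrite mulr_ge0; lia.
      lia.
    have : 0 <= (K + K) * k%:Z by rewrite mulr_ge0; lia.
    have : (K + K) * k.+1%:Z = (K + K) * k%:Z + (K + K) by lia.
    lia.
  have := hk D; have := flux_bounds p q (n + (K + K) * D%:Z) sF; lia.
have left1 (n : int) : flux p q F n = D%:Z -> forall m, m <= n + 1 -> F m = m.
  move=> fn m mn; pose k := Order.min m (- R1).
  have hlin (i : int) : k <= i < n + 1 -> F (i + 1) = F i + 1.
    move=> hi; have := @flux_anti p q F hF i n; have := flux_bounds p q i sF.
    have := flux_slope i e sF; have := sF i; rewrite fn -/D; lia.
  rewrite (linear_on hlin); last by rewrite /k; lia.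
  by have [h1 _] := hR1 k; rewrite h1; rewrite /k; lia.
have right0 (n : int) : flux p q F n = 0 -> forall m, n <= m -> F m = 0.
  move=> fn m mn; pose k := Order.max m R1.
  have hlin (i : int) : m <= i < k -> F (i + 1) = F i + 0.
    move=> hi; have := @flux_anti p q F hF n i; have := flux_bounds p q i sF.
    have := flux_slope i e sF; have := sF i; rewrite fn -/D; lia.
  by have := linear_on (m := k) hlin; have [_ h1] := hR1 k; rewrite h1; rewrite /k; lia.
have fle (n : int) : flux p q F n <= D%:Z.
  by have := flux_bounds p q n sF; rewrite -/D; lia.
(* Were the flux below [D] at [- R], it would vanish at [-1] and give [F (-1) = 0], against
   [F n <= n]; were it [D] at 1, then [F 1 = 1], against [F n <= 0]. *)
move=> n; split=> hn.
  have [fR|fR] := ltP (flux p q F (- R)) D%:Z; last first.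
    by apply: (left1 (- R)); have := fle (- R); lia.
  have R1E : - R + (K + K) * D%:Z = -1 by rewrite /R; ring.
  have := right0 _ (drop _ fR) (-1); rewrite R1E => /(_ (lexx _)) F1.
  by have [] := profile_le (-1) pF; rewrite F1.
have [fR|fR] := ltP (flux p q F 1) D%:Z.
  by apply: (right0 R) => //; rewrite -(drop _ fR) /R addrC.
have f1 : flux p q F 1 = D%:Z by have := fle 1; lia.
by have [_] := profile_le 1 pF; rewrite (left1 1 f1).
Qed.

Definition least_profile (p q : int) (F : int -> int) : Prop :=
  profile p q F /\ forall G, profile p q G -> forall n, F n <= G n.

(** The pointwise minimum of all profiles is finite by [profile_support], and slopes in {0,1} and
    superharmonicity survive minima. *)
Lemma least_profile_exists (p q p' q' : int) : p' * q - p * q' = 1 ->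
  exists F, least_profile p q F.
Proof.
move=> e; have [R R0 hR] := profile_support e.
have p0 : profile p q (fun n => Order.min n 0).
  split=> [n|n|]; [by lia|by rewrite /lap; lia|by exists 0 => n; lia].
pose T := {G : int -> int | profile p q G}.
have /choice[F hF] : forall n, exists z, (exists2 G, profile p q G & G n = z) /\
    forall G, profile p q G -> z <= G n.
  move=> n; have [|[G pG] hG] :=
      @bounded_below_attains T (fun G => sval G n) (Order.min n (- R)) (exist _ _ p0).
    move=> [G pG] /=; have [sG _ _] := pG.
    have := @slow_between G (Order.min n (- R)) n sG.
    have [+ _] := hR G pG (Order.min n (- R)).
    lia.
  exists (G n); split; first by exists G.
  by move=> G' pG'; have := hG (exist _ _ pG').
exists F; split; last by move=> G pG n; case: (hF n) => _; apply.
split=> [n|n|].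
- have [[G pG Gn] hn] := hF n; have [[G' pG' Gn'] hn'] := hF (n + 1).
  have [sG _ _] := pG; have [sG' _ _] := pG'.
  by have := sG n; have := sG' n; have := hn G' pG'; have := hn' G pG; lia.
- have [[G pG Gn] _] := hF n; have [_ sG _] := pG; have := sG n; rewrite /lap Gn.
  have [_ /(_ G pG)] := hF (n + q); have [_ /(_ G pG)] := hF (n - q).
  by have [_ /(_ G pG)] := hF (n + p); have [_ /(_ G pG)] := hF (n - p); lia.
- by exists R => n; have [[G pG <-] _] := hF n; apply: hR.
Qed.

(** * Existence *)

(** The least action characterization of the toppling function of a wave, as [wave_minimal] provides
    it. *)
Definition least_wave (v : vertex) (phi h : state) : Prop :=
  [/\ forall w, 0 <= h w <= 1, h v = 1,
      forall w, phi w + laplacian h w <= 3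
    & forall X : state, (forall w, 0 <= X w) -> 1 <= X v ->
        (forall w, phi w + laplacian X w <= 3) -> forall w, h w <= X w].

Lemma lap_shift (p q k : int) (f : int -> int) (n : int) :
  lap p q (fun m => f (m + k)) n = lap p q f (n + k).
Proof. by rewrite /lap !(addrAC _ k). Qed.

Lemma lap_shift_add (p q k d : int) (f : int -> int) (n : int) :
  lap p q (fun m => f (m + k) + d) n = lap p q f (n + k).
Proof. by rewrite /lap !(addrAC _ k); ring. Qed.

Lemma lapD (p q : int) (f g : int -> int) (n : int) :
  lap p q (fun m => f m + g m) n = lap p q f n + lap p q g n.
Proof. by rewrite /lap; ring. Qed.

Lemma lapB (p q : int) (f g : int -> int) (n : int) :
  lap p q (fun m => f m - g m) n = lap p q f n - lap p q g n.
Proof. by rewrite /lap; ring. Qed.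

Lemma eq_lap (p q : int) (f g : int -> int) : f =1 g -> lap p q f =1 lap p q g.
Proof. by move=> e n; rewrite /lap !e. Qed.

Lemma height_add (p q s t : int) (v : vertex) :
  height p q (v.1 + s, v.2 + t) = height p q v + (q * s - p * t).
Proof. by rewrite /height /=; ring. Qed.

Lemma height_translate (p q p' q' : int) (v : vertex) : p' * q - p * q' = 1 ->
  height p q (v.1 + p', v.2 + q') = height p q v + 1.
Proof. by move=> e; rewrite height_add -e; ring. Qed.

(** At a vertex with 3 grains the values of [h] at the neighbours sum to at most four times its own,
    so a firing neighbour forces it to fire. The path goes horizontally, then vertically. *)
Lemma fire_path (phi h : state) (v : vertex) (a b : int) :
  (forall w, 0 <= h w) -> (forall w, phi w + laplacian h w <= 3) ->
  (forall s t : int, `|s| <= `|a| + 1 -> `|t| <= `|b| + 1 ->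
     phi (v.1 + s, v.2 + t) = 3) ->
  1 <= h v -> 1 <= h (v.1 + a, v.2 + b).
Proof.
move=> h0 hphi hab hv.
have fire (y : vertex) : phi y = 3 -> [\/ 1 <= h (y.1 + 1, y.2), 1 <= h (y.1 - 1, y.2),
    1 <= h (y.1, y.2 + 1) | 1 <= h (y.1, y.2 - 1)] -> 1 <= h y.
  move=> y3; have := hphi y; rewrite /laplacian y3.
  have := h0 (y.1 + 1, y.2); have := h0 (y.1 - 1, y.2).
  have := h0 (y.1, y.2 + 1); have := h0 (y.1, y.2 - 1).
  by move: (h _) (h _) (h _) (h _) (h _) => > ? ? ? ? ? []; lia.
have h1 : 1 <= h (v.1 + a, v.2).
  rewrite -(mulr1 a).
  apply: (@walk (fun x => `|x - v.1| <= `|a|) (fun x => 1 <= h (x, v.2))) => [x hx Px|x|].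
  - split; apply: fire => /=.
    + by rewrite -[v.2]addr0 -[_ + 1](subrK v.1) addrC; apply: hab; lia.
    + by apply: Or42; rewrite addrK.
    + by rewrite -[v.2]addr0 -[_ - 1](subrK v.1) addrC; apply: hab; lia.
    + by apply: Or41; rewrite subrK.
  - by rewrite mulr1.
  - by case: (v) hv.
rewrite -(mulr1 b).
apply: (@walk (fun y => `|y - v.2| <= `|b|) (fun y => 1 <= h (v.1 + a, y)))
  => [y hy Py|y|//].
  split; apply: fire => /=.
  - by rewrite -[_ + 1](subrK v.2) [_ + v.2]addrC; apply: hab; lia.
  - by apply: Or44; rewrite addrK.
  - by rewrite -[_ - 1](subrK v.2) [_ + v.2]addrC; apply: hab; lia.
  - by apply: Or43; rewrite subrK.
by rewrite mulr1.
Qed.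

(** The translates of [h] by [(p, q)] and its opposite fire at [v] by [fire_path], so both are
    competitors and bound [h]. The margin below [R] keeps the box of [fire_path] in the region of
    3s. *)
Lemma least_wave_periodic (p q : int) (v : vertex) (phi h : state) (R : int) :
  periodic p q phi -> least_wave v phi h ->
  (forall w, height p q w <= R -> phi w = 3) ->
  height p q v + (`|q| * (`|p| + 1) + `|p| * (`|q| + 1)) <= R ->
  periodic p q h.
Proof.
move=> pphi [h01 hv hphi hmin] phi3 vR.
have h0 w : 0 <= h w by case/andP: (h01 w).
have le_translate a b : periodic a b phi -> `|a| = `|p| -> `|b| = `|q| ->
    forall w, h w <= translate a b h w.
  move=> pab ap bq; apply: hmin => [w|//|w]; first exact: h0.
    apply: (@fire_path phi) => //; last by rewrite hv.
    move=> s t; rewrite ap bq => hs ht; apply: phi3; rewrite height_add.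
    have := ler_norm (q * s - p * t); have := ler_normB (q * s) (p * t).
    have := ler_wpM2l (normr_ge0 q) hs; have := ler_wpM2l (normr_ge0 p) ht.
    rewrite !normrM; lia.
  by rewrite laplacian_translate pab /translate.
have nphi : periodic (- p) (- q) phi.
  by move=> w; rewrite [RHS]pphi /translate /= !subrK; case: w.
move=> w; apply/eqP; rewrite eq_le le_translate //=.
have := le_translate (- p) (- q) nphi (normrN _) (normrN _) (w.1 + p, w.2 + q).
by rewrite /translate /= !addrK; case: w.
Qed.

Definition soliton (p q : int) (F : int -> int) : state :=
  fun v => 3 + lap p q F (height p q v).

(** Adding [F] to the competitors of the wave makes them superharmonic majorants of [F]; [F + eta]
    is the least one that exceeds [F] at the source. *)
Lemma least_wave_1d (p q p' q' : int) (F eta : int -> int) (v : vertex) (h : state) :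
  p' * q - p * q' = 1 ->
  least_wave v (soliton p q F) h -> (forall w, h w = eta (height p q w)) ->
  [/\ forall n, 0 <= eta n <= 1, eta (height p q v) = 1,
      forall n, lap p q (fun m => F m + eta m) n <= 0
    & forall X : int -> int, (forall n, F n <= X n) ->
        F (height p q v) + 1 <= X (height p q v) ->
        (forall n, lap p q X n <= 0) -> forall n, F n + eta n <= X n].
Proof.
move=> e [h01 hv hphi hmin] hE; split=> [n||n|X FX Xv lX n].
- by rewrite -(height_mul n e) -hE.
- by rewrite -hE.
- rewrite -(height_mul n e) lapD -(laplacian_height _ _ eta).
  by rewrite -(eq_laplacian hE); have := hphi (n * p', n * q'); rewrite /soliton; lia.
have := hmin (fun w => X (height p q w) - F (height p q w)).
rewrite -(height_mul n e) => /(_ _ _ _ (n * p', n * q')); rewrite hE.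
move=> H; have := H; rewrite -lerBrDl; apply => [w||w].
- by rewrite subr_ge0.
- lia.
- rewrite (laplacian_height p q (fun m => X m - F m)) lapB /soliton.
  by have := lX (height p q w); lia.
Qed.

(** [F (. + 1)] is a competitor, hence a bound ([le1]). Comparing [F + eta] with its own translate
    raised by 1 bounds its slope by 1 ([le2]), so moved one step right it is a profile, and [F] lies
    below it. *)
Lemma least_profile_shift (p q : int) (F eta : int -> int) (c : int) :
  least_profile p q F ->
  (forall n, 0 <= eta n) -> (forall n : int, n <= c + 1 -> F n = n) ->
  (forall n : int, n <= c -> eta n = 1) ->
  (forall n, lap p q (fun m => F m + eta m) n <= 0) ->
  (forall X : int -> int, (forall n, F n <= X n) -> F c + 1 <= X c ->
     (forall n, lap p q X n <= 0) -> forall n, F n + eta n <= X n) ->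
  forall n, F n + eta n = F (n + 1).
Proof.
move=> [[sF lF [R hR]] minF] eta0 Fc etac leta etamin.
have le1 n : F n + eta n <= F (n + 1).
  apply: (etamin (fun m => F (m + 1))) => [{}n||{}n].
  - by case/andP: (sF n).
  - by rewrite !Fc; lia.
  - by rewrite (lap_shift p q 1 F); apply: lF.
have le2 n : F n + eta n <= F (n - 1) + eta (n - 1) + 1.
  apply: (etamin (fun m => F (m - 1) + eta (m - 1) + 1)) => [{}n||{}n].
  - by have := sF (n - 1); have := eta0 (n - 1); rewrite subrK; lia.
  - by rewrite etac ?Fc; lia.
  - by rewrite (lap_shift_add p q (-1) 1 (fun m => F m + eta m)).
have pX : profile p q (fun n => F (n - 1) + eta (n - 1)).
  split=> [n|n|].
  - have := le2 n; have := le1 (n - 1); have := eta0 n.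
    by rewrite (addrK 1 n) (subrK 1 n); lia.
  - by rewrite (lap_shift p q (-1) (fun m => F m + eta m)).
  - exists (`|R| + `|c| + 1) => n.
    split=> hn.
      by rewrite Fc ?etac; lia.
    have := le1 (n - 1); have := eta0 (n - 1); have [_ h1] := hR (n - 1).
    have [_ h2] := hR n; rewrite (subrK 1 n) h1 ?h2; lia.
move=> n; apply/eqP; rewrite eq_le le1 /=.
by have := minF _ pX (n + 1); rewrite (addrK 1 n).
Qed.

Lemma soliton_periodic (p q : int) (F : int -> int) : periodic p q (soliton p q F).
Proof.
by move=> v; rewrite /translate /soliton height_add mulrC subrr addr0.
Qed.

Lemma translate_soliton (p q p' q' : int) (F : int -> int) v : p' * q - p * q' = 1 ->
  translate p' q' (soliton p q F) v = 3 + lap p q F (height p q v + 1).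
Proof. by move=> e; rewrite /translate /soliton height_translate. Qed.

Lemma lap_linear_left (p q : int) (F : int -> int) (a b : int) :
  (forall n : int, n <= a -> F n = n + b) ->
  forall n : int, n + `|p| + `|q| <= a -> lap p q F n = 0.
Proof. by move=> hF n hn; rewrite /lap !hF; lia. Qed.

Lemma soliton_movable_by (p q p' q' : int) (F : int -> int) :
  p' * q - p * q' = 1 -> least_profile p q F -> movable_by p' q' (soliton p q F).
Proof.
move=> e lF; have [[sF supF [R hR]] _] := lF.
split; first by move=> [p0 q0]; move: e; rewrite p0 q0 mul0r mulr0 subrr.
pose phi := soliton p q F.
have stphi : stable phi.
  by move=> w; rewrite /phi /soliton; have := supF (height p q w); lia.
pose S := - R - `|p| - `|q|.
have phi3 w : height p q w <= S -> phi w = 3.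
  move=> hw; rewrite /phi /soliton (@lap_linear_left p q F (- R) 0) ?addr0 //.
    by move=> n hn; rewrite addr0; apply: (hR n).1.
  by move: hw; rewrite /S; lia.
(* The source is low enough for the box of [least_wave_periodic], the walks of [walk_unit] and a
   further step by [p] or [q] to stay below [S]. *)
pose c := S - (`|q| * (`|p| + 1) + `|p| * (`|q| + 1))
  - (`|p' * q| + `|q' * p|) - `|p| - `|q| - 1.
have [qp0 pq0] : 0 <= `|q| * (`|p| + 1) /\ 0 <= `|p| * (`|q| + 1).
  by rewrite !mulr_ge0 //; lia.
pose v : vertex := (c * p', c * q').
have vc : height p q v = c by apply: height_mul.
have vS : height p q v + (`|q| * (`|p| + 1) + `|p| * (`|q| + 1)) <= S.
  rewrite vc /c; lia.
have [psi hpsi] : exists psi, wave v phi psi.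
  apply: (@wave_exists _ _ (v.1 + 1, v.2 + 0)) => //.
  - by apply: phi3; lia.
  - apply: phi3; rewrite height_add vc mulr1 mulr0 subr0 /c.
    lia.
  - rewrite /neighbours /=; ring.
have [h [h01 hv hpsiE stpsi hmin]] := wave_minimal stphi hpsi.
have lw : least_wave v phi h by split=> // w; rewrite -hpsiE.
have ph : periodic p q h.
  by apply: (least_wave_periodic (@soliton_periodic p q F) lw phi3).
pose eta n := h (n * p', n * q').
have hE w : h w = eta (height p q w) by apply: periodic_height.
have [eta01 etac leta etamin] := least_wave_1d e lw hE.
have lap3 n : lap p q F n + lap p q eta n <= 0 by rewrite -lapD.
have lapF0 n : n <= S -> lap p q F n = 0.
  move=> nS; apply: (@lap_linear_left p q F (- R) 0) => [m hm|].
    by rewrite addr0; apply: (hR m).1.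
  by move: nS; rewrite /S; lia.
have fire n : n <= S ->
    [\/ 1 <= eta (n + q), 1 <= eta (n - q), 1 <= eta (n + p) | 1 <= eta (n - p)] ->
    1 <= eta n.
  move=> nS; have := lap3 n; rewrite (lapF0 _ nS) /lap.
  have := eta01 (n + q); have := eta01 (n - q).
  have := eta01 (n + p); have := eta01 (n - p).
  by move: (eta _) (eta _) (eta _) (eta _) (eta _) => > ? ? ? ? ? []; lia.
(* Where [lap p q F] vanishes, a firing neighbour forces firing, so the wave reaches every height
   below its source. *)
have down (k : nat) : 1 <= eta (c - k%:Z).
  elim: k => [|k IH]; first by rewrite subr0 -vc etac.
  have -> : c - k.+1%:Z = c - k%:Z - 1 by lia.
  suff [_ //] : 1 <= eta (c - k%:Z + 1) /\ 1 <= eta (c - k%:Z - 1).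
  apply: (@walk_unit p q p' q' (fun i => i <= S - `|p| - `|q|)
      (fun i => 1 <= eta i)) => //.
    move=> i hi Pi; split; apply: fire; try lia.
    - by apply: Or42; rewrite addrK.
    - by apply: Or41; rewrite subrK.
    - by apply: Or44; rewrite addrK.
    - by apply: Or43; rewrite subrK.
  by move=> i; rewrite /c; lia.
have etaE (n : int) : n <= c -> eta n = 1.
  move=> nc; have := down `|c - n|%N; have -> : c - `|c - n|%N%:Z = n by lia.
  by have := eta01 n; lia.
exists v; apply: eq_wave hpsi => w.
rewrite hpsiE translate_soliton // (eq_laplacian hE) laplacian_height.
rewrite /phi /soliton -addrA -lapD -(lap_shift p q 1 F); congr (_ + _).
apply: eq_lap => n; apply: (@least_profile_shift p q F eta c lF) => //.
- by move=> m; case/andP: (eta01 m).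
- by move=> m hm; apply: (hR m).1; move: hm; rewrite /c /S; lia.
- by rewrite -vc.
Qed.

(** A period of height 1 would make [lap p q F] constant, hence 0 as on the far left; then [- F]
    would be harmonic and nonnegative, hence constant. *)
Lemma soliton_not_periodic (p q p' q' : int) (F : int -> int) :
  p' * q - p * q' = 1 -> profile p q F -> ~ periodic p' q' (soliton p q F).
Proof.
move=> e [sF lF [R hR]] per.
have lap_step n : lap p q F (n + 1) = lap p q F n.
  have := per (n * p', n * q'); rewrite (translate_soliton _ _ e) /soliton (height_mul n e).
  by move/addrI.
have lap0 (n : int) : lap p q F n = 0.
  pose a := Order.min n (- R - `|p| - `|q|).
  apply: (@int_up_ind a (fun m => lap p q F m = 0)) => [|m _ hm|].
  - apply: (@lap_linear_left p q F (- R) 0) => [m hm|]; last by rewrite /a; lia.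
    by rewrite addr0; apply: (hR m).1.
  - by rewrite lap_step.
  - by rewrite /a; lia.
have pF : profile p q F by split=> //; exists R.
have nlap n : lap p q (fun m => - F m) n <= 0 by have := lap0 n; rewrite /lap; lia.
have npos n : 0 <= - F n by have [_] := profile_le n pF; lia.
have := lap_constant e nlap npos (- R) (- R - 1).
by rewrite (hR (- R)).1 // (hR (- R - 1)).1; lia.
Qed.

(** * Uniqueness *)

(** Translated, the first hypothesis says that the wave from [v - j] moves [F (. + j)] to
    [F (. + j + 1)]. So [X] bounds each further wave as long as it exceeds the current function at
    the source. *)
Lemma iterated_wave (p q : int) (F X : int -> int) (v : int) (N : nat) :
  (forall Y : int -> int, (forall n, F n <= Y n) -> F v + 1 <= Y v ->
     (forall n, lap p q Y n <= 0) -> forall n, F (n + 1) <= Y n) ->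
  (forall n, lap p q X n <= 0) -> (forall n, F n <= X n) ->
  (forall j : nat, (j < N)%N -> (forall n, F (n + j%:Z) <= X n) ->
     F v + 1 <= X (v - j%:Z)) ->
  forall n, F (n + N%:Z) <= X n.
Proof.
move=> W lX FX; elim: N => [|N IH] hN n; first by rewrite addr0.
have IHN : forall n, F (n + N%:Z) <= X n by apply: IH => j jN; apply: hN; apply: ltnW.
have := W (fun m => X (m - N%:Z)) _ _ _ (n + N%:Z).
rewrite addrK; have -> : n + N.+1%:Z = n + N%:Z + 1 by lia.
apply=> [m||m].
- by have := IHN (m - N%:Z); rewrite subrK.
- exact: hN.
- by rewrite (lap_shift p q (- N%:Z) X).
Qed.

(* If the wave from [v] translates [F], then [F] drops below [v] at least as
   much as anywhere else, so it is linear up to [v].  Waves can then be sent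
   from far left, and the least action principle for iterated waves compares
   [F] with translates of any other profile. *)
Lemma movable_profile_least (p q p' q' : int) (F : int -> int) (v : int) :
  p' * q - p * q' = 1 -> profile p q F -> lap p q F v = 0 -> F (v + 1) = F v + 1 ->
  (forall Y : int -> int, (forall n, F n <= Y n) -> F v + 1 <= Y v ->
     (forall n, lap p q Y n <= 0) -> forall n, F (n + 1) <= Y n) ->
  least_profile p q F.
Proof.
move=> e pF lv Fv W; split=> // Y pY.
have [R R0 hR] := profile_support e.
have [sF supF _] := pF; have [sY supY _] := pY.
(* The competitor is [F + i], with [i] the drop from [v + 1] to [m]. It bounds [v + 1 - m] waves,
   and on the far left this says that [i] is at least [v + 1 - m]. *)
have drop (m : int) : m <= v + 1 -> F m = F (v + 1) - (v + 1 - m).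
  move=> mv; pose t := `|(v + 1 - m)%R|%N.
  have tE : t%:Z = v + 1 - m by rewrite /t; lia.
  have := slow_between sF mv.
  have [i iE] : exists i, i = F (v + 1) - F m by exists (F (v + 1) - F m).
  move=> hi; have i0 : 0 <= i by lia.
  have li n : lap p q (fun n => F n + i) n <= 0.
    by move: (supF n); rewrite /lap; lia.
  have Fi n : F n <= F n + i by lia.
  have hN (j : nat) : (j < t)%N -> (forall n, F (n + j%:Z) <= F n + i) ->
      F v + 1 <= F (v - j%:Z) + i.
    move=> jt _; have mj : m <= v - j%:Z by lia.
    by have := slow_between sF mj; lia.
  have := iterated_wave W li Fi hN (- R - t%:Z); rewrite subrK.
  by rewrite (hR F pF (- R)).1 // (hR F pF (- R - t%:Z)).1; lia.
have Flin (m : int) : m <= v + 1 -> F m = m.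
  move=> mv; pose k := Order.min m (- R).
  have km : k <= m /\ k <= - R by rewrite /k; lia.
  have Fk := (hR F pF k).1 km.2.
  by have := drop k; have := drop m; lia.
(* As [F n <= n], harmonicity at [v] carries the equality [F n = n] on to the neighbours of [v] on
   its right. *)
have Flin2 (m : int) : m <= v + `|p| \/ m <= v + `|q| -> F m = m.
  move: lv; rewrite lap_norm /lap !(Flin (v - _)); [|lia|lia].
  rewrite (Flin v); last by lia.
  have [h1 _] := profile_le (v + `|p|) pF; have [h2 _] := profile_le (v + `|q|) pF.
  move=> h3 hm.
  have {h3} [h3 h4] : F (v + `|p|) = v + `|p| /\ F (v + `|q|) = v + `|q| by lia.
  have [hm1 _] := profile_le m pF.
  by case: hm => hm; have := slow_between sF hm; lia.
have lv0 (n : int) : n <= v -> lap p q F n = 0.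
  move=> nv; rewrite lap_norm /lap !Flin2; lia.
(* Moved left by [R + R], [Y] lies above [F], and it remains to bound [N] waves by it. *)
pose N := `|(R + R)%R|%N.
have NE : N%:Z = R + R by rewrite /N; lia.
suff H n : F (n + N%:Z) <= Y (n + N%:Z) by move=> n; rewrite -(subrK N%:Z n).
apply: (iterated_wave (X := fun n => Y (n + N%:Z)) W) => {}n.
- by rewrite (lap_shift p q N%:Z Y).
- have [F1 F2] := profile_le n pF.
  have [nR|nR] := leP R (n + N%:Z); first by rewrite (hR Y pY _).2.
  pose k := Order.min (n + N%:Z) (- R).
  have kn : k <= n + N%:Z by rewrite /k; lia.
  have := slow_between sY kn; rewrite (hR Y pY k).1; rewrite /k; lia.
move=> jN FY.
(* On the far left the gap is [N - n], which is positive. Strictness propagates: equality at a point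
   where [F] is harmonic would spread to its neighbours. *)
have strict (k : int) : - R - `|v| - n%:Z - N%:Z <= k -> k <= v - n%:Z ->
    F (k + n%:Z) + 1 <= Y (k + N%:Z).
  move=> hk.
  suff H : forall l : int, l <= k -> k <= v - n%:Z -> F (l + n%:Z) + 1 <= Y (l + N%:Z).
    exact: H.
  move: k hk; apply: int_up_ind => [l hl _|k hk IH l lk kv].
    rewrite (hR F pF _).1; last by lia.
    by rewrite (hR Y pY _).1; lia.
  have {}IH l' : l' <= k -> F (l' + n%:Z) + 1 <= Y (l' + N%:Z) by move=> ?; apply: IH; lia.
  have [lk'|lk'] := leP l k; first exact: IH.
  have {lk lk'}-> : l = k + 1 by lia.
  have := lv0 (k + 1 + n%:Z) ltac:(lia); have := supY (k + 1 + N%:Z).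
  rewrite (lap_norm _ _ F) (lap_norm _ _ Y) /lap.
  rewrite !(addrAC (k + 1) n%:Z) !(addrAC (k + 1) N%:Z).
  have := FY (k + 1 + `|p|); have := FY (k + 1 - `|p|).
  have := FY (k + 1 + `|q|); have := FY (k + 1 - `|q|).
  have [pp|p0] := ltP 0 `|p|.
    have := IH (k + 1 - `|p|) ltac:(lia); move: (F _) (F _) (F _) (F _) (F _).
    by move: (Y _) (Y _) (Y _) (Y _) (Y _) => *; lia.
  have [qq|q0] := ltP 0 `|q|.
    have := IH (k + 1 - `|q|) ltac:(lia); move: (F _) (F _) (F _) (F _) (F _).
    by move: (Y _) (Y _) (Y _) (Y _) (Y _) => *; lia.
  have p00 : p = 0 by lia.
  have q00 : q = 0 by lia.
  by move: e; rewrite p00 q00 mulr0 mul0r.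
have := strict (v - n%:Z); rewrite subrK; apply; lia.
Qed.

Lemma lap_opp (p q : int) (f : int -> int) (n : int) :
  lap p q (fun m => f (- m)) n = lap p q f (- n).
Proof.
rewrite /lap; have -> : - (n + q) = - n - q by lia.
have -> : - (n - q) = - n + q by lia.
have -> : - (n + p) = - n - p by lia.
have -> : - (n - p) = - n + p by lia.
ring.
Qed.

Lemma lap_reflect (p q : int) (F : int -> int) (n : int) :
  lap p q (fun m => F (- m) + m) n = lap p q F (- n).
Proof. by rewrite (lapD p q (fun m => F (- m)) id) lap_opp /lap; ring. Qed.

(** Slope [s] becomes [1 - s] and the two ends are exchanged; this serves for waves that move the
    state in the opposite direction. *)
Lemma profile_reflect (p q : int) (F : int -> int) :
  profile p q F -> profile p q (fun n => F (- n) + n).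
Proof.
move=> [sF lF [R hR]]; split=> [n|n|].
- have := sF (- (n + 1)); have -> : - (n + 1) + 1 = - n by lia.
  lia.
- by rewrite lap_reflect.
- exists R => n; split=> hn; first by rewrite (hR (- n)).2; lia.
  by rewrite (hR (- n)).1; lia.
Qed.

Lemma least_profile_reflect (p q : int) (F : int -> int) :
  least_profile p q F -> least_profile p q (fun n => F (- n) + n).
Proof.
move=> [pF minF]; split=> [|G pG n]; first exact: profile_reflect.
have := minF _ (profile_reflect pG) (- n); rewrite opprK; lia.
Qed.

(** In the superharmonic region a value 1 spreads to both sides by [walk_unit], so 0 and 1 cannot
    both occur far left. *)
Lemma constant_left (p q p' q' : int) (H : int -> int) (S : int) :
  p' * q - p * q' = 1 -> (forall n, 0 <= H n <= 1) ->
  (forall n : int, n <= S -> lap p q H n <= 0) ->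
  exists2 S' : int, S' <= S & forall n : int, n <= S' -> H n = H S'.
Proof.
move=> e H01 hS.
have fire n : n <= S ->
    [\/ 1 <= H (n + q), 1 <= H (n - q), 1 <= H (n + p) | 1 <= H (n - p)] ->
    1 <= H n.
  move=> /hS; rewrite /lap.
  have := H01 (n + q); have := H01 (n - q); have := H01 (n + p); have := H01 (n - p).
  by move: (H _) (H _) (H _) (H _) (H _) => > ? ? ? ? ? []; lia.
pose S' := S - `|p| - `|q| - (`|p' * q| + `|q' * p|).
have step (n : int) : n <= S' -> 1 <= H n -> 1 <= H (n + 1) /\ 1 <= H (n - 1).
  move=> nS; apply: (@walk_unit p q p' q' (fun i => i <= S - `|p| - `|q|)
      (fun i => 1 <= H i)) => // [i hi Pi|i]; last by move: nS; rewrite /S'; lia.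
  split; apply: fire; try lia.
  - by apply: Or42; rewrite addrK.
  - by apply: Or41; rewrite subrK.
  - by apply: Or44; rewrite addrK.
  - by apply: Or43; rewrite subrK.
exists S'; first by rewrite /S'; lia.
have hk (k : nat) : H (S' - k%:Z) = H S'.
  elim: k => [|k <-]; first by rewrite subr0.
  have E : S' - k%:Z = S' - k.+1%:Z + 1 by lia.
  have := step (S' - k%:Z) ltac:(lia); have := step (S' - k.+1%:Z) ltac:(lia).
  rewrite -E; have -> : S' - k%:Z - 1 = S' - k.+1%:Z by lia.
  have := H01 (S' - k%:Z); have := H01 (S' - k.+1%:Z).
  by move: (H _) (H _) (H _) (H _) => *; lia.
move=> n nS; rewrite -(hk `|(S' - n)%R|%N); congr H; lia.
Qed.

(** [F n] is minus the sum of [K] over [n], [n + m], and so on, which is finite since [K] vanishes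
    on the right. *)
Lemma potential_exists (K : int -> int) (m S : int) : 0 < m ->
  (forall n : int, S <= n -> K n = 0) ->
  exists F : int -> int,
    (forall n, F (n + m) = F n + K n) /\ (forall n : int, S <= n -> F n = 0).
Proof.
move=> m0 KS.
pose sK (J : nat) (n : int) : int := \sum_(j < J) K (n + j%:Z * m).
have sKS J n : S <= n + J%:Z * m -> forall J', (J <= J')%N -> sK J' n = sK J n.
  move=> nS J' /subnKC<-; rewrite /sK big_split_ord /= [X in _ + X]big1 ?addr0 // => i _.
  by apply: KS; have : 0 <= i%:Z * m by [rewrite mulr_ge0; lia]; rewrite PoszD mulrDl; lia.
pose J (n : int) := (`|S| + `|n|)%N.
have hJ n : S <= n + (J n)%:Z * m.
  have : (J n)%:Z <= (J n)%:Z * m by rewrite -{1}[(J n)%:Z]mulr1 ler_wpM2l; lia.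
  by rewrite {1}/J; lia.
exists (fun n => - sK (J n) n); split=> n.
  set J0 := maxn (J n) (J (n + m)).
  rewrite -(sKS _ _ (hJ (n + m)) J0) ?leq_maxr // -(sKS _ _ (hJ n) J0.+1); last first.
    by rewrite /J0; lia.
  rewrite /sK big_ord_recl /= mul0r addr0 opprD addrAC addNr add0r.
  by congr (- _); apply: eq_bigr => j _; congr K; rewrite /bump /=; lia.
move=> nS; rewrite (sKS 0%N n) ?mul0r ?addr0 //.
by rewrite /sK big_ord0 oppr0.
Qed.

Lemma shift_invariant_zero (E : int -> int) (m S : int) : 0 < m ->
  (forall n, E (n + m) = E n) -> (forall n : int, S <= n -> E n = 0) -> forall n, E n = 0.
Proof.
move=> m0 Em ES n.
have hk (k : nat) : E (n + k%:Z * m) = E n.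
  elim: k => [|k IH]; first by rewrite mul0r addr0.
  by rewrite -IH -[RHS]Em; congr E; lia.
rewrite -(hk (`|S| + `|n|)%N); apply: ES.
have : (`|S| + `|n|)%N%:Z <= (`|S| + `|n|)%N%:Z * m.
  by rewrite -{1}[X in X <= _]mulr1 ler_wpM2l; lia.
lia.
Qed.

Lemma bounded_below_outside (F : int -> int) (m a b : int) : 0 < m ->
  (forall n : int, n < a -> F (n + m) <= F n) ->
  (forall n : int, b < n -> F (n - m) <= F n) ->
  exists B, forall n, B <= F n.
Proof.
move=> m0 Fa Fb.
have win (k : nat) : exists B, forall n, `|n| <= k%:Z -> B <= F n.
  elim: k => [|k [B hB]].
    by exists (F 0) => n hn; have -> : n = 0 by lia.
  exists (Order.min B (Order.min (F k.+1%:Z) (F (- k.+1%:Z)))) => n hn.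
  have [nk|nk] := leP `|n| k%:Z; first by have := hB n nk; lia.
  have [->|->] : n = k.+1%:Z \/ n = - k.+1%:Z by lia.
    lia.
  lia.
have [B hB] := win (`|a| + `|b| + `|m|)%N.
exists B.
suff hk (k : nat) n : `|n| <= k%:Z -> B <= F n by move=> n; apply: (hk `|n|%N); lia.
elim: k n => [|k IH] n hn; first by apply: hB; lia.
have [nw|nw] := leP `|n| (`|a| + `|b| + `|m|)%N%:Z; first exact: hB.
have [n0|n0] := ltP n 0.
  by apply: le_trans (IH (n + m) _) (Fa n _); lia.
by apply: le_trans (IH (n - m) _) (Fb n _); lia.
Qed.

(** The harmonic extension of the left end of [F] gains 1 over each [m] steps. Its slope is periodic
    and harmonic, hence a constant integer [g 0] with [m * g 0 = 1]. *)
Lemma movable_slope (p q p' q' : int) (f F H : int -> int) (m S : int) :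
  p' * q - p * q' = 1 -> 0 < m ->
  (forall n, F (n + m) = F n + H n) -> (forall n, lap p q F n = f n) ->
  (forall n : int, n <= S -> H n = 1) -> (forall n : int, n <= S -> f n = 0) -> m = 1.
Proof.
move=> e m0 FH lF HS fS.
(* [G] extends the left end of [F] to a harmonic function on Z. *)
have [Q [Qm QS]] := @potential_exists (fun i => H (- i - m) - 1) m (- S - m) m0
  ltac:(move=> n hn /=; rewrite HS; lia).
pose G n := F n + Q (- n).
have Gm n : G (n + m) = G n + 1.
  rewrite /G FH; have := Qm (- n - m); rewrite subrK => ->.
  have -> : - (- n - m) - m = n by lia.
  have -> : - (n + m) = - n - m by lia.
  lia.
have lG n : lap p q G n = 0.
  rewrite -[n]opprK -(lap_opp p q G).
  apply: (@shift_invariant_zero _ m (- S + m + `|p| + `|q|) m0) => {}n => [|hn].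
    rewrite !lap_opp; have := lap_shift_add p q m (-1) G (- (n + m)).
    have -> : - (n + m) + m = - n by lia.
    by move=> <-; apply: eq_lap => i; rewrite Gm; lia.
  rewrite lap_opp -(fS (- n)); last by lia.
  rewrite -lF /lap /G !QS; lia.
pose g n := G (n + 1) - G n.
have gm (n : int) : g (n + m) = g n.
  by rewrite /g (addrAC n m 1) !Gm opprD addrACA subrr addr0.
have gmN n : g (n - m) = g n by rewrite -(gm (n - m)) subrK.
have [B hB] : exists B, forall n, B <= g n.
  by apply: (@bounded_below_outside g m 0 0 m0) => n _; rewrite ?gm ?gmN.
have lg n : lap p q g n <= 0.
  by rewrite lapB (lap_shift p q 1 G) !lG.
have gc n : g n = g 0 by apply: (lap_constant e lg hB).
have Gn (k : nat) : G k%:Z = G 0 + k%:Z * g 0.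
  elim: k => [|k IH]; first by rewrite mul0r addr0.
  have := gc k%:Z; rewrite {1}/g IH.
  have -> : k%:Z + 1 = k.+1%:Z by lia.
  lia.
have := Gn `|m|%N; have := Gm 0; rewrite add0r.
have -> : `|m|%N%:Z = m by lia.
move=> -> /addrI h1.
have : (m %| 1)%Z by apply/dvdzP; exists (g 0); rewrite mulrC.
by rewrite dvdz1; lia.
Qed.

Lemma movable_potential (p q p' q' : int) (f H : int -> int) (m S v : int) :
  p' * q - p * q' = 1 -> 0 < m ->
  (forall n, f n <= 0) -> (exists n, f n <> 0) ->
  (forall n : int, S <= `|n| -> f n = 0) ->
  (forall n, 0 <= H n <= 1) -> (forall n, lap p q H n = f (n + m) - f n) ->
  f v = 0 -> H v = 1 ->
  (forall F X : int -> int, (forall n, lap p q F n = f n) ->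
     (forall n, F n <= X n) -> F v + 1 <= X v ->
     (forall n, lap p q X n <= 0) -> forall n, F n + H n <= X n) ->
  exists2 F, least_profile p q F & exists d, forall n, f n = lap p q F (n + d).
Proof.
move=> e m0 f0 [n1 fn1] fS H01 lH fv Hv minH.
have [S1 S1S H1] : exists2 S' : int, S' <= - `|S| &
    forall n : int, n <= S' -> H n = H S'.
  apply: (constant_left e H01) => n hn.
  by rewrite lH (fS n) ?subr0; [exact: f0|lia].
have [S2' S2S H2'] : exists2 S' : int, S' <= - `|S| &
    forall n : int, n <= S' -> H (- n) = H (- S').
  apply: (constant_left e (H := fun n => H (- n))) => // n hn.
  by rewrite lap_opp lH (fS (- n)) ?subr0; [exact: f0|lia].
have [S2 S2E] : exists S2 : int, S2' = - S2 by exists (- S2'); rewrite opprK.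
have H2 (n : int) : S2 <= n -> H n = H S2.
  move=> hn; rewrite -[n]opprK H2' ?S2E ?opprK //; lia.
(* Subtracting the right end value of [H] lets it be integrated from the right. *)
pose K n := H n - H S2.
have K0 (n : int) : S2 <= n -> K n = 0 by move=> hn; rewrite /K H2 ?subrr.
have [F [FK FS]] := potential_exists m0 K0.
have lF n : lap p q F n = f n.
  apply/eqP; rewrite -subr_eq0; apply/eqP.
  apply: (@shift_invariant_zero (fun n => lap p q F n - f n) m (`|S2| + `|S| + `|p| + `|q|) m0)
    => {}n => [|hn].
    rewrite -(lap_shift p q m F) (eq_lap p q FK) lapD.
    by have := lH n; rewrite /K /lap; lia.
  by rewrite (fS n); [rewrite /lap !FS; lia|lia].
(* If [H] did not drop from 1 to 0, [F] would be bounded below, hence constant, and [f] would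
   vanish. *)
have HS : H S1 = 1 /\ H S2 = 0.
  have := H01 S1; have := H01 S2.
  have [le|] := leP (H S1) (H S2); last by lia.
  have [B hB] : exists B, forall n, B <= F n.
    apply: (@bounded_below_outside F m S1 (S2 + m) m0) => n hn.
      by rewrite FK /K (H1 n); lia.
    by rewrite !FS; lia.
  case: fn1; have F0 n : F n = 0.
    by rewrite -(FS S2) //; apply: (lap_constant e _ hB) => i; rewrite lF.
  by rewrite -lF /lap !F0.
case: HS => H1S H2S.
have FH n : F (n + m) = F n + H n by rewrite FK /K H2S subr0.
have m1 : m = 1.
  by apply: (@movable_slope p q p' q' f F H m S1) => // n hn; [rewrite H1|apply: fS; lia].
rewrite m1 in FH.
(* The shift by [d] normalizes the left end to [F0 n = n]. *)
pose d := F S1 - S1.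
have FL (n : int) : n <= S1 -> F n = n + d.
  move=> nS; have lin (i : int) : n <= i < S1 -> F (i + 1) = F i + 1.
    by move=> hi; rewrite FH H1 ?H1S //; lia.
  by have := linear_on lin (m := S1); rewrite /d mul1r; lia.
pose F0 n := F (n - d).
have lF0 n : lap p q F0 n = f (n - d) by rewrite (lap_shift p q (- d) F) lF.
exists F0; last by exists d => n; rewrite lF0 addrK.
apply: (@movable_profile_least p q p' q' F0 (v + d) e).
- split=> [n|n|].
  + by rewrite /F0 (addrAC n 1 (- d)) FH lerDl lerD2l; exact: H01.
  + by rewrite lF0.
  + exists (`|S1| + `|S2| + `|d|) => n; split=> hn; rewrite /F0.
      by rewrite FL; lia.
    by rewrite FS; lia.
- by rewrite lF0 addrK.
- by rewrite /F0 (addrAC _ 1 (- d)) addrK FH Hv.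
- move=> Y FY Yv lY n; rewrite /F0 (addrAC n 1 (- d)) FH -[n in Y n](subrK d n).
  apply: (minH F (fun i => Y (i + d)) lF) => [i||i].
  + by have := FY (i + d); rewrite /F0 addrK.
  + by move: Yv; rewrite /F0 addrK.
  + by rewrite (lap_shift p q d Y).
Qed.

(** The translate of [h] by [(p, q)] minus [h] is harmonic and bounded, hence constant; a nonzero
    constant would change [h] by at least 2 over two periods. *)
Lemma wave_height_periodic (p q s t : int) (psi h : state) :
  periodic p q psi -> (forall w, 0 <= h w <= 1) ->
  (forall w, translate s t psi w = psi w + laplacian h w) -> periodic p q h.
Proof.
move=> per h01 hE.
pose g w := translate p q h w - h w.
have lg w : laplacian g w <= 0.
  rewrite laplacianB laplacian_translate.
  have := hE w; have := hE (w.1 + p, w.2 + q); rewrite [psi w]per.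
  have -> : translate s t psi (w.1 + p, w.2 + q) = translate s t psi w.
    by rewrite [RHS]/translate [RHS]per /translate /= !(addrAC _ p) !(addrAC _ q).
  rewrite /translate => -> /addrI ->; lia.
have gB w : -1 <= g w.
  by rewrite /g /translate; have := h01 (w.1 + p, w.2 + q); have := h01 w; lia.
have gc := superharmonic_constant lg gB.
move=> w; have := gc w (w.1 + p, w.2 + q); rewrite /g /translate /=.
have := h01 w; have := h01 (w.1 + p, w.2 + q); have := h01 (w.1 + p + p, w.2 + q + q).
by move: (h _) (h _) (h _) => *; lia.
Qed.

(** A point without 3 grains recurs along [(p, q)], so the strip is parallel to [(p, q)]; its linear
    form is then the height times a nonzero [l]. *)
Lemma line_shaped_height (R : realType) (p q p' q' : int) (psi : state) (n1 : int) :
  p' * q - p * q' = 1 -> periodic p q psi -> line_shaped R psi ->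
  psi (n1 * p', n1 * q') <> 3 ->
  exists S : int, forall n : int, S <= `|n| -> psi (n * p', n * q') = 3.
Proof.
move=> e per [a [b [c1 [c2 [ab hc]]]]] hn1.
pose P (x : int) : R := x%:~R.
have PM x y : P (x * y) = P x * P y by apply: intrM.
have PD x y : P (x + y) = P x + P y by apply: intrD.
have eP : P p' * P q - P p * P q' = 1 by rewrite -!PM -[LHS]intrB e.
pose M := `|c1| + `|c2|.
have cM x : c1 <= x <= c2 -> `|x| <= M.
  move=> /andP[h1 h2]; rewrite /M ler_norml; apply/andP; split.
    by have := ler_norm (- c1); rewrite normrN; have := normr_ge0 c2; lra.
  by have := ler_norm c2; have := normr_ge0 c1; lra.
pose D := a * P p + b * P q.
pose A := a * P (n1 * p') + b * P (n1 * q').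
have hk k : `|A + P k * D| <= M.
  apply: cM; have := hc (n1 * p' + k * p) (n1 * q' + k * q).
  have -> : A + P k * D = a * P (n1 * p' + k * p) + b * P (n1 * q' + k * q).
    by rewrite /A /D !PD !PM; ring.
  by apply; rewrite -(periodic_mul k (n1 * p', n1 * q') per).
have big (x y : R) : 0 < x -> exists k : nat, y < k%:R * x.
  move=> x0; exists (Num.bound `|y / x|).
  rewrite -ltr_pdivrMr //; apply: le_lt_trans (ler_norm _) _.
  exact/archi_boundP/normr_ge0.
have D0 : D = 0.
  apply/eqP/negPn/negP => D0.
  have [k hkb] := big `|D| (M + `|A|) ltac:(by rewrite normr_gt0).
  have := hk k%:Z; have := ler_normB (A + P k%:Z * D) A.
  rewrite [A + _]addrC addrK normrM /P -pmulrn normr_nat; lra.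
pose l := a * P p' + b * P q'.
have l0 : l != 0.
  apply/eqP => l0; apply: ab.
  have -> : a = l * P q - D * P q'.
    by rewrite -[LHS]mulr1 -eP /l /D; ring.
  have -> : b = D * P p' - l * P p.
    by rewrite -[LHS]mulr1 -eP /l /D; ring.
  by rewrite l0 D0 !mul0r subrr.
have [k hkb] := big `|l| M ltac:(by rewrite normr_gt0).
exists k%:Z => n kn; apply/eqP/negPn/negP => /eqP /hc.
have -> : a * (n * p')%:~R + b * (n * q')%:~R = P n * l.
  by rewrite -/(P (n * p')) -/(P (n * q')) !PM /l; ring.
move=> /cM; rewrite normrM => h1.
have : k%:R <= `|P n| by rewrite /P -intr_norm pmulrn ler_int.
have := normr_ge0 l => hl hkn.
have := ler_wpM2r hl hkn; lra.
Qed.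

Lemma movable_soliton_pos (R : realType) (p q p' q' s t : int) (psi : state) :
  p' * q - p * q' = 1 -> movable_by s t psi -> ~ periodic s t psi ->
  periodic p q psi -> line_shaped R psi -> 0 < height p q (s, t) ->
  exists2 F, least_profile p q F &
    exists d, forall n, psi (n * p', n * q') - 3 = lap p q F (n + d).
Proof.
move=> e [_ [v hv]] nper per ls m0.
(* The wave ends in a translate of [psi], and its end state is stable. *)
have stpsi : stable psi.
  have [_ _ [N [u [H [_ _ _ _ st]]]]] := hv.
  move=> w; have := st (w.1 - s, w.2 - t); rewrite /translate /= !subrK.
  by case: w.
have [h [h01 hv1 hE _ hmin]] := wave_minimal stpsi hv.
have ph := wave_height_periodic per h01 hE.
pose f n := psi (n * p', n * q') - 3.
have psiE w : psi w = 3 + f (height p q w).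
  by rewrite (periodic_height w e per) /f addrC subrK.
have hH w : h w = h (height p q w * p', height p q w * q') := periodic_height w e ph.
pose H n := h (n * p', n * q').
have lapH w : laplacian h w = lap p q H (height p q w).
  by rewrite (eq_laplacian hH) (laplacian_height p q H).
pose m := height p q (s, t).
have hst w : height p q (w.1 + s, w.2 + t) = height p q w + m by rewrite height_add.
have [n1 fn1] : exists n, f n <> 0.
  apply: contrapT => /forallNP f0; apply: nper => w.
  by rewrite /translate !psiE; have /contrapT -> := f0 (height p q w);
     have /contrapT -> := f0 (height p q (w.1 + s, w.2 + t)).
have [S hS] : exists S : int, forall n : int, S <= `|n| -> psi (n * p', n * q') = 3.
  apply: (@line_shaped_height R p q p' q' psi n1) => // h3.
  by apply: fn1; rewrite /f h3 subrr.
apply: (@movable_potential p q p' q' f H m S (height p q v)) => //.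
- by move=> n; rewrite /f; have := stpsi (n * p', n * q'); lia.
- by exists n1.
- by move=> n /hS; rewrite /f => ->; rewrite subrr.
- by move=> n; apply: h01.
- move=> n; have := hE (n * p', n * q'); rewrite lapH /translate !psiE hst.
  by rewrite (height_mul n e); lia.
- by have [v3 _ _] := hv; move: v3; rewrite psiE; lia.
- by rewrite /H -hH.
- move=> F X lF FX Xv lX n.
  have := hmin (fun w => X (height p q w) - F (height p q w)) _ _ _ (n * p', n * q').
  rewrite (height_mul n e) -/(H n) => hX; rewrite -lerBrDl; apply: hX => [w||w].
  + by rewrite subr_ge0.
  + by rewrite -lerBrDl in Xv *; lia.
  + rewrite (laplacian_height p q (fun m => X m - F m)) lapB lF psiE.
    by have := lX (height p q w); lia.
Qed.

Lemma profile_opp (p q : int) (F : int -> int) :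
  profile (- p) (- q) F -> profile p q F.
Proof.
move=> [sF lF hF]; split=> // n.
by have := lF n; rewrite /lap !opprK; lia.
Qed.

(** Two least profiles coincide, so only the shift [d] of the height remains, and the vector
    [(d * p', d * q')] realizes it. *)
Lemma movable_soliton (R : realType) (p q p' q' : int) (F : int -> int) (psi : state) :
  p' * q - p * q' = 1 -> least_profile p q F ->
  movable psi -> periodic p q psi -> line_shaped R psi ->
  equal_up_to_translation (soliton p q F) psi.
Proof.
move=> e lF [s [t [mst nper]]] per ls.
suff [G lG [d hd]] : exists2 G, least_profile p q G &
    exists d, forall n, psi (n * p', n * q') - 3 = lap p q G (n + d).
  exists (d * p'), (d * q') => v; rewrite (periodic_height v e per).
  rewrite -[LHS](subrK 3) hd addrC /translate /soliton; congr (_ + _).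
  rewrite height_add; have -> : q * (d * p') - p * (d * q') = d.
    by rewrite -[RHS]mulr1 -e; ring.
  apply: eq_lap => n; apply/eqP; rewrite eq_le.
  by have [pF mF] := lF; have [pG mG] := lG; rewrite mF // mG.
have [m0|m0|m0] := ltgtP 0 (height p q (s, t)).
- exact: (movable_soliton_pos e mst nper per ls m0).
(* Passing to [(- p, - q)] makes the height of the displacement positive; reflecting the profile
   returns to [(p, q)]. *)
- have e' : (- p') * (- q) - (- p) * (- q') = 1 by rewrite -[RHS]e; ring.
  have per' : periodic (- p) (- q) psi.
    by move=> w; rewrite [RHS]per /translate /= !subrK; case: w.
  have [|G [pG mG] [d hd]] := movable_soliton_pos e' mst nper per' ls.
    by move: m0; rewrite /height; lia.
  exists (fun n => G (- n) + n).
    apply: least_profile_reflect; split; first exact: profile_opp.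
    by move=> G' pG'; apply: mG; apply: profile_opp; rewrite !opprK.
  exists (- d) => n; rewrite lap_reflect.
  have := hd (- n); rewrite !mulrNN => ->.
  have -> : - (n - d) = - n + d by lia.
  by rewrite /lap !opprK; ring.
(* A displacement of height 0 is a period of [psi]. *)
- case: nper => w; rewrite /translate (periodic_height w e per).
  by rewrite (periodic_height (w.1 + s, w.2 + t) e per) height_add -/(height p q (s, t)) -m0 addr0.
Qed.

Theorem theorem1p4 (R : realType) (p q : int) (hpq : gcdz p q = 1) :
  exists phi : state,
    [/\ movable phi /\ periodic p q phi /\ line_shaped R phi,
        forall psi : state,
          movable psi /\ periodic p q psi /\ line_shaped R psi ->
          equal_up_to_translation phi psi
      & forall p' q' : int, p' * q - p * q' = 1 -> movable_by p' q' phi].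
Proof.
have [p' [q' e]] : exists p' q' : int, p' * q - p * q' = 1.
  have [u [w]] := Bezoutz p q; rewrite hpq => h.
  by exists w, (- u); rewrite -h; ring.
have [F lF] := least_profile_exists e.
have [pF _] := lF; have [_ _ [S hS]] := pF.
exists (soliton p q F); split=> [|psi [mpsi [per ls]]|p1 q1 e1].
- split; last split.
  + by exists p', q'; split; [apply: soliton_movable_by|apply: (soliton_not_periodic e)].
  + exact: soliton_periodic.
  (* The strip is the set of heights between [- c] and [c], where [c] adds the reach of [lap] to the
     bound [S] on the bend of [F]. *)
  + pose c := `|S| + `|p| + `|q|.
    exists q%:~R, (- p)%:~R, (- c)%:~R, c%:~R; split.
      move=> [/eqP q0 /eqP p0]; move: q0 p0; rewrite !intr_eq0 oppr_eq0 => /eqP q0 /eqP p0.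
      by move: e; rewrite p0 q0 mulr0 mul0r.
    move=> x y hxy; rewrite -!intrM -intrD !ler_int.
    have -> : q * x + - p * y = height p q (x, y) by rewrite /height /=; ring.
    apply: contraPT hxy => hc; apply; rewrite /soliton.
    move: (height p q (x, y)) hc => n hc.
    suff -> : lap p q F n = 0 by [].
    have [nc|nc] : n < - c \/ c < n by lia.
      apply: (@lap_linear_left p q F (- S) 0) => [i hi|]; last by move: nc; rewrite /c; lia.
      by rewrite addr0; apply: (hS i).1.
    by rewrite /lap !(hS _).2; move: nc; rewrite /c; lia.
- exact: (movable_soliton e lF mpsi per ls).
- exact: soliton_movable_by.
Qed.
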